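(* There is a function $\varepsilon(n)$ with $\varepsilon(n)\to 0$ as $n\to\infty$ such that for every positive integer $n$, \[T(n)\le \left((1+\varepsilon(n))\frac{n}{e^3}\right)^{n}.\]
   Context: Index the rows and columns of an $n\times n$ board by $\mathbb{Z}_n$. A toroidal $n$-queens configuration is a set $\{(x_i,y_i)\}_{i=1}^n\subseteq \mathbb{Z}_n^2$ such that each of $\{x_i\}_i$, $\{y_i\}_i$, $\{x_i+y_i\}_i$, $\{x_i-y_i\}_i$ equals all of $\mathbb{Z}_n$. $T(n)$ denotes the number of toroidal $n$-queens configurations. *)

(* Defs.v *)
(* MathComp / MathComp-Analysis. *)
From HB Require Import structures.
From mathcomp Require Import all_boot all_order all_algebra.
From mathcomp Require Import all_classical all_reals all_analysis.
Set Implicit Arguments.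
Unset Strict Implicit.
Unset Printing Implicit Defensive.
Import Order.TTheory GRing.Theory Num.Theory.
Import numFieldNormedType.Exports.
Local Open Scope ring_scope.

(* Z_n for n > 0, with addition modulo n.  MathComp's 'Z_n is not used because
   'Z_1 has two elements; 'I_n itself carries a group structure only when n is
   syntactically a successor, whence n.-1.+1. *)
Notation Zmod n := 'I_n.-1.+1.

(* The cardinality condition encodes the indexing of the points by 1, ..., n. *)
Definition toroidal_queens (n : nat) (S : {set Zmod n * Zmod n}) : bool :=
  [&& #|S| == n,
      [set p.1 | p in S] == [set: Zmod n],
      [set p.2 | p in S] == [set: Zmod n],
      [set p.1 + p.2 | p in S] == [set: Zmod n]
    & [set p.1 - p.2 | p in S] == [set: Zmod n]].

(* Meaningful for n > 0 only. *)
Definition T (n : nat) : nat :=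
  #|[set S : {set Zmod n * Zmod n} | toroidal_queens S]|.

(* Main.v *)
(* View a configuration as the function [f] from rows to columns.  Give each row
   a random time and reveal the queens in order of time; if the row [x] had
   [M x] columns available when its turn came, then [1 / prod M] is at most the
   probability that choosing an available column uniformly at each step produces
   [f], so these numbers add up to at most 1 over all [f].  Average over the
   times.  A square off the configuration in row [x] is attacked by three queens
   in distinct rows other than [x], so the expected value of [M x], given that a
   proportion [1 - t] of the times precedes that of [x], is [1 + (n - 1) t^3].
   By Jensen's inequality [ln (T n) / n] is at most the average of
   [ln (1 + (n - 1) t^3)], about [ln n + 3 \int_0^1 ln t dt = ln n - 3].
   Times take [m = q^2] values only, which costs [9 / q + q^6 / n]. *)
Require Import Defs.
From HB Require Import structures.
From mathcomp Require Import all_boot all_order all_algebra.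
From mathcomp Require Import all_classical all_reals all_analysis.
From mathcomp Require Import ring lra.
Import Order.TTheory GRing.Theory Num.Theory.
Import numFieldNormedType.Exports.
Local Open Scope ring_scope.
Set Implicit Arguments.
Unset Strict Implicit.
Unset Printing Implicit Defensive.

(** * Choosing values one at a time *)

(* [\prod M^-1] is at most the probability that [f] results from choosing its
   values along [s], each uniformly among those that extend to a member of [F]. *)
Lemma sum_prod_inv_choices_le1 (R : numFieldType) (X Y : finType)
    (M : {ffun X -> Y} -> X -> nat) (s : seq X) (F : {set {ffun X -> Y}}) :
  {in F &, forall f g : {ffun X -> Y}, {in s, f =1 g} -> f = g} ->
  (forall s1 x s2, s = s1 ++ x :: s2 -> {in F, forall f : {ffun X -> Y},
    (#|[set (g : {ffun X -> Y}) x | g in [set h in F | all (fun z => h z == f z) s1]]|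
       <= M f x)%N}) ->
  \sum_(f in F) \prod_(x <- s) (M f x)%:R^-1 <= 1 :> R.
Proof.
elim: s F => [|x s IHs] F Finj FM.
  under eq_bigr do rewrite big_nil.
  rewrite sumr_const -[leRHS]/(1%:R) ler_nat.
  by apply/card_le1_eqP => f g fF gF; apply: Finj.
rewrite (partition_big_imset (fun f : {ffun X -> Y} => f x)) /=.
set I := [set (f : {ffun X -> Y}) x | f in F]%SET.
(* The members of [F] with value [y] at [x] satisfy the hypotheses along [s], so by induction they
   contribute at most [1 / #|I|]; there are [#|I|] such classes. *)
have leI (y : Y) : y \in I ->
    \sum_(f in F | f x == y) \prod_(z <- x :: s) (M f z)%:R^-1 <= #|I|%:R^-1 :> R.
  move=> yI; have I0 : (0 < #|I|)%N by apply/card_gt0P; exists y.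
  have step (f : {ffun X -> Y}) : (f \in F) && (f x == y) ->
      \prod_(z <- x :: s) (M f z)%:R^-1 <=
      #|I|%:R^-1 * \prod_(z <- s) (M f z)%:R^-1 :> R.
    case/andP=> fF _; rewrite big_cons ler_wpM2r ?prodr_ge0//.
    have IM : (#|I| <= M f x)%N.
      apply: leq_trans (FM [::] x s erefl f fF); apply/subset_leq_card/fintype.subsetP.
      by move=> _ /imsetP[g gF ->]; apply/imsetP; exists g; rewrite // inE gF.
    by rewrite lef_pV2 ?ler_nat ?posrE ?ltr0n// (leq_trans I0).
  apply: le_trans (ler_sum _ step) _.
  rewrite -big_distrr /= -[leRHS]mulr1 ler_wpM2l// .
  rewrite (eq_bigl (fun f => f \in [set h : {ffun X -> Y} in F | h x == y]%SET));
    last by move=> f; rewrite inE.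
  apply: IHs => [f g|].
    rewrite !inE => /andP[fF /eqP fx] /andP[gF /eqP gx] fg; apply: Finj => // z.
    by rewrite inE => /orP[/eqP ->|/fg//]; rewrite fx gx.
  move=> s1 z s2 es f; rewrite inE => /andP[fF /eqP fx].
  apply: leq_trans (FM (x :: s1) z s2 (congr1 (cons x) es) f fF).
  apply/subset_leq_card/fintype.subsetP => _ /imsetP[g gF ->].
  by apply/imsetP; exists g => //; move: gF; rewrite !inE /= fx andbA.
apply: le_trans (ler_sum _ leI) _.
rewrite sumr_const -[_^-1 *+ _]mulr_natr.
have [->|I0] := eqVneq #|I| 0%N; first by rewrite mulr0.
by rewrite mulVf// pnatr_eq0.
Qed.

(** * Averages over random times *)

(** Expectation when the times [tau x] are independent and uniform on ['I_m]. *)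
Definition mean {R : numFieldType} {X : finType} {m : nat}
    (phi : {ffun X -> 'I_m} -> R) : R :=
  (m%:R ^- #|X|) * \sum_tau phi tau.

(** Independence of the coordinates of [tau]. *)
Lemma mean_prod (R : numFieldType) (X : finType) (m : nat) (G : X -> 'I_m -> R) :
  mean (fun tau => \prod_z G z (tau z)) = \prod_z (m%:R^-1 * \sum_i G z i).
Proof.
by rewrite big_split /= prodr_const /mean bigA_distr_bigA /= exprVn.
Qed.

Lemma meanZ (R : numFieldType) (X : finType) (m : nat) (c : R)
    (phi : {ffun X -> 'I_m} -> R) : mean (fun tau => c * phi tau) = c * mean phi.
Proof. by rewrite /mean -big_distrr /= mulrCA. Qed.

Lemma mean_sum (R : numFieldType) (X : finType) (m : nat) (I : finType)
    (P : pred I) (phi : I -> {ffun X -> 'I_m} -> R) :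
  mean (fun tau => \sum_(i | P i) phi i tau) = \sum_(i | P i) mean (phi i).
Proof. by rewrite /mean exchange_big big_distrr. Qed.

Lemma meanD (R : numFieldType) (X : finType) (m : nat)
    (phi psi : {ffun X -> 'I_m} -> R) :
  mean (fun tau => phi tau + psi tau) = mean phi + mean psi.
Proof. by rewrite /mean big_split mulrDr. Qed.

Lemma meanN (R : numFieldType) (X : finType) (m : nat)
    (phi : {ffun X -> 'I_m} -> R) : mean (fun tau => - phi tau) = - mean phi.
Proof. by rewrite /mean sumrN mulrN. Qed.

Lemma eq_mean (R : numFieldType) (X : finType) (m : nat)
    (phi psi : {ffun X -> 'I_m} -> R) : phi =1 psi -> mean phi = mean psi.
Proof. by move=> e; rewrite /mean (eq_bigr psi). Qed.

Lemma ler_mean (R : numFieldType) (X : finType) (m : nat)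
    (phi psi : {ffun X -> 'I_m} -> R) :
  (forall tau, phi tau <= psi tau) -> mean phi <= mean psi.
Proof.
by move=> le; rewrite /mean ler_wpM2l ?invr_ge0 ?exprn_ge0//; apply: ler_sum.
Qed.

Lemma mean_cst (R : numFieldType) (X : finType) (m : nat) (c : R) :
  (0 < m)%N -> mean (fun _ : {ffun X -> 'I_m} => c) = c.
Proof.
move=> m0; rewrite /mean sumr_const card_ffun card_ord -[c *+ _]mulr_natl mulrA natrX.
by rewrite mulVf ?mul1r// expf_neq0// pnatr_eq0 -lt0n.
Qed.

(** Given [tau x = k], each of the independent times [tau z] is at least [k] with probability
    [(m - k) / m]. *)
Lemma mean_thresholds (R : numFieldType) (X : finType) (m : nat) (x : X)
    (Z : {set X}) (g : 'I_m -> R) :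
  x \notin Z ->
  mean (fun tau => g (tau x) * \prod_(z in Z) (tau x <= tau z)%N%:R) =
  m%:R^-1 * \sum_k g k * ((m - k)%:R / m%:R) ^+ #|Z|.
Proof.
move=> xZ.
(* For fixed [k], the product of [G k z (tau z)] over [z] is the indicator of [tau x = k] and
   [tau z >= k] on [Z], in the form that [mean_prod] factors. *)
pose G (k : 'I_m) z (i : 'I_m) : R :=
  if z == x then (i == k)%:R else if z \in Z then (k <= i)%N%:R else 1.
have prodG k (tau : {ffun X -> 'I_m}) : \prod_z G k z (tau z) =
    (tau x == k)%:R * \prod_(z in Z) (k <= tau z)%N%:R.
  rewrite (bigD1 x)//= {1}/G eqxx; congr (_ * _).
  rewrite [RHS](eq_bigl (fun z => (z != x) && (z \in Z))); last first.
    by move=> z; case: eqVneq => // ->; rewrite (negbTE xZ).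
  rewrite big_mkcondr; apply: eq_bigr => z zx; rewrite /G (negbTE zx).
  by [].
rewrite (eq_mean (psi := fun tau => \sum_k g k * \prod_z G k z (tau z))); last first.
  move=> tau; rewrite (bigD1 (tau x))//= prodG eqxx mul1r.
  rewrite [X in _ = _ + X]big1 ?addr0// => k kx.
  by rewrite prodG eq_sym (negbTE kx) mul0r mulr0.
rewrite mean_sum big_distrr /=; apply: eq_bigr => k _.
have m0 : m%:R != 0 :> R by rewrite pnatr_eq0 -lt0n; case: m k {g G prodG} => [[]|].
rewrite meanZ mean_prod mulrCA; congr (_ * _).
rewrite (bigD1 x)//= {1}/G eqxx (bigD1 k)//= eqxx big1 ?addr0 ?mulr1; last first.
  by move=> i /negbTE ->.
congr (_ * _).
rewrite -prodr_const.
rewrite [RHS](eq_bigl (fun z => (z != x) && (z \in Z))); last first.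
  by move=> z; case: eqVneq => // ->; rewrite (negbTE xZ).
rewrite [RHS]big_mkcondr; apply: eq_bigr => z zx; rewrite /G (negbTE zx).
case: (z \in Z); last by rewrite sumr_const card_ord mulVf.
rewrite mulrC -natr_sum; congr (_%:R * _).
have -> : (m - k = \sum_(i < m | (k <= i)%N) 1)%N.
  by rewrite -(big_geq_mkord k m xpredT (fun=> 1%N)) sum_nat_const_nat muln1.
by rewrite [RHS]big_mkcond; apply: eq_bigr => i _; case: leqP.
Qed.

(** * Configurations as functions from rows to columns *)

Definition queens (p : nat) : {set {ffun 'I_p.+1 -> 'I_p.+1}} :=
  [set f : {ffun _ -> _} | [&& injectiveb f, injectiveb (fun x => x + f x)
             & injectiveb (fun x => x - f x)]].

Lemma queensP (p : nat) (f : {ffun 'I_p.+1 -> 'I_p.+1}) :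
  reflect [/\ injective f, injective (fun x => x + f x) &
              injective (fun x => x - f x)] (f \in queens p).
Proof. by rewrite inE; apply: (iffP and3P) => -[/injectiveP ? /injectiveP ? /injectiveP ?]. Qed.

(** Each of the four maps sends the [p.+1] points of a configuration onto [p.+1] residues, so it is
    injective there; hence the configuration is the graph of a member of [queens]. *)
Lemma T_le_queens (p : nat) : (T p.+1 <= #|queens p|)%N.
Proof.
pose graph (f : {ffun 'I_p.+1 -> 'I_p.+1}) := [set (x, f x) | x : 'I_p.+1]%SET.
apply: leq_trans _ (leq_imset_card graph (queens p)).
apply/subset_leq_card/fintype.subsetP => S.
rewrite inE => /and5P[/eqP cS /eqP S1 /eqP S2 /eqP S3 /eqP S4].
have inj (g : 'I_p.+1 * 'I_p.+1 -> 'I_p.+1) :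
    [set g u | u in S]%SET = [set: 'I_p.+1]%SET -> {in S &, injective g}.
  by move=> gS; apply/imset_injP; rewrite gS cardsT card_ord cS.
have exy x : exists y, (x, y) \in S.
  have : x \in [set u.1 | u in S]%SET by rewrite S1 inE.
  by case/imsetP => -[a b] abS /= ->; exists b.
pose f := [ffun x => xchoose (exy x)].
have fS x : (x, f x) \in S by rewrite ffunE; exact: (xchooseP (exy x)).
have Sf u : u \in S -> u = (u.1, f u.1).
  by move=> uS; apply: (inj (fun u => u.1)) => //=.
apply/imsetP; exists f.
  apply/queensP; split=> x x' e.
  - by case: (inj _ S2 _ _ (fS x) (fS x') e).
  - by case: (inj _ S3 _ _ (fS x) (fS x') e).
  - by case: (inj _ S4 _ _ (fS x) (fS x') e).
apply/setP => u; apply/idP/imsetP => [/Sf ->|[x _ ->]//].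
by exists u.1.
Qed.

(* Summing the diagonals gives [s = s + s] for the sum [s] of all residues,
   whereas [s = n / 2] modulo an even [n]. *)
Lemma queens_odd (p : nat) (f : {ffun 'I_p.+1 -> 'I_p.+1}) :
  f \in queens p -> odd p.+1.
Proof.
case/queensP => f_inj fD_inj _.
have s0 : \sum_(x : 'I_p.+1) x = 0 :> 'I_p.+1.
  have eD : \sum_x x = \sum_x (x + f x) by rewrite (reindex_inj fD_inj).
  have ef : \sum_x x = \sum_x f x by rewrite (reindex_inj f_inj).
  by move/eqP: eD; rewrite big_split /= -ef -subr_eq subrr => /eqP <-.
have sE : \sum_(x : 'I_p.+1) x = inZp (\sum_(x < p.+1) x) :> 'I_p.+1.
  rewrite (big_morph (inZp (p' := p)) (id1 := 0) (op1 := +%R)).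
  - by apply: eq_bigr => x _; rewrite valZpK.
  - by move=> a b; apply: val_inj; rewrite /= modnDm.
  - by apply: val_inj; rewrite /= mod0n.
have : (p.+1 %| 'C(p.+1, 2))%N.
  rewrite -bin2_sum big_mkord /dvdn.
  by move/(congr1 val): sE; rewrite s0 /= => <-.
(* If [p.+1 = 2 q], then [2 q] divides the binomial [q p], so [p] is even too, which is absurd. *)
rewrite bin2 [_.-1]/= => dv; apply: contraLR isT => even_p.
have /dvdnP[q pq] : (2 %| p.+1)%N by rewrite dvdn2.
move: dv; have -> : ((p.+1 * p)./2 = q * p)%N.
  by rewrite pq mulnAC muln2 doubleK.
have q0 : (0 < q)%N by case: q pq.
by rewrite pq dvdn_pmul2l// dvdn2 => op; move: even_p; rewrite /= op.
Qed.

(** The difference [x - z] is killed by 2 and by the odd number [p.+1]. *)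
Lemma Zp_double_inj (p : nat) : odd p.+1 -> injective (fun x : 'I_p.+1 => x + x).
Proof.
move=> op x z /eqP; rewrite -subr_eq0 => /eqP xz; apply/eqP; rewrite -subr_eq0.
have d2 : (x - z) *+ 2 = 0 by rewrite mulr2n addrACA -opprD.
have : (x - z) *+ p.+1 = 0.
  by rewrite Zp_mulrn; apply: val_inj; rewrite /= modnMl.
by rewrite -(odd_double_half p.+1) op mulrnDr -muln2 mulnC mulrnA d2 mul0rn addr0 mulr1n => ->.
Qed.


(** * Free columns and the queens attacking a square *)

(* [tau x] is the time at which the queen in row [x] is revealed. *)
Definition free (p m : nat) (tau : {ffun 'I_p.+1 -> 'I_m})
    (f : {ffun 'I_p.+1 -> 'I_p.+1}) (x : 'I_p.+1) : {set 'I_p.+1} :=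
  [set y | [forall z, (tau z < tau x)%N ==>
     [&& y != f z, x + y != z + f z & x - y != z - f z]]].

Lemma mem_free (p m : nat) (tau : {ffun 'I_p.+1 -> 'I_m})
    (f g : {ffun 'I_p.+1 -> 'I_p.+1}) (x : 'I_p.+1) :
  g \in queens p -> (forall z, (tau z < tau x)%N -> g z = f z) ->
  g x \in free tau f x.
Proof.
move=> /queensP[g1 g2 g3] gf; rewrite inE; apply/forallP => z; apply/implyP => zx.
have xz : x != z by apply: contraTneq zx => ->; rewrite ltnn.
by rewrite -(gf z zx) (inj_eq g1) (inj_eq g2) (inj_eq g3) xz.
Qed.

(** Rows are sorted by time. Rows with equal times do not block each other in [free], so
    [free tau f x] contains every column available at the turn of [x], however ties are broken. *)
Lemma sum_prod_inv_free_le1 (R : numFieldType) (p m : nat)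
    (tau : {ffun 'I_p.+1 -> 'I_m}) :
  \sum_(f in queens p) \prod_x #|free tau f x|%:R^-1 <= 1 :> R.
Proof.
pose le_tau : rel 'I_p.+1 := fun x z => (tau x <= tau z)%N.
pose s := sort le_tau (enum 'I_p.+1).
have le_tau_trans : transitive le_tau by move=> y x z; apply: leq_trans.
have s_sorted : sorted le_tau s by apply: sort_sorted => x z; apply: leq_total.
have s_all x : x \in s by rewrite mem_sort mem_enum.
have s_perm : perm_eq (index_enum 'I_p.+1) s.
  by rewrite perm_sym perm_sort enumT.
under eq_bigr do rewrite (perm_big _ s_perm) /=.
apply: sum_prod_inv_choices_le1 => [f g _ _ fg|s1 x s2 es f fQ].
  by apply/ffunP => x; apply: fg.
apply/subset_leq_card/fintype.subsetP => _ /imsetP[g + ->].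
rewrite inE => /andP[gQ /allP eq_gf].
apply: mem_free => // z tau_zx; apply/eqP/eq_gf.
have := s_all z; rewrite es mem_cat => /orP[//|zs2].
move: s_sorted; rewrite es sorted_pairwise// pairwise_cat => /and3P[_ _ /= /andP[+ _]].
move: zs2; rewrite inE => /orP[/eqP zx|zs2]; first by rewrite zx ltnn in tau_zx.
by move/allP/(_ z zs2); rewrite /le_tau leqNgt tau_zx.
Qed.

(** The column and the two diagonals through [(x, y)] each carry one queen, since the three maps are
    bijective; [Z] consists of the rows of these queens. *)
Lemma attackers (p m : nat) (f : {ffun 'I_p.+1 -> 'I_p.+1}) (x y : 'I_p.+1) :
  f \in queens p -> y != f x ->
  exists Z : {set 'I_p.+1}, [/\ x \notin Z, #|Z| = 3%N &
    forall tau : {ffun 'I_p.+1 -> 'I_m}, y \in free tau f x ->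
      {in Z, forall z, (tau x <= tau z)%N}].
Proof.
move=> fQ yfx; have op := queens_odd fQ; case/queensP: fQ => f1 f2 f3.
have [z1 e1] : exists z, y = f z by exists (invF f1 y); rewrite f_invF.
have [z2 e2] : exists z, x + y = z + f z.
  by exists (invF f2 (x + y)); rewrite (f_invF f2).
have [z3 e3] : exists z, x - y = z - f z.
  by exists (invF f3 (x - y)); rewrite (f_invF f3).
have x1 : x != z1 by apply: contra_neq yfx => ->.
have x2 : x != z2.
  by apply: contra_neq yfx => xz; apply: (addrI x); rewrite e2 xz.
have x3 : x != z3.
  by apply: contra_neq yfx => xz; apply: oppr_inj; apply: (addrI x); rewrite e3 xz.
have z12 : z1 != z2.
  by apply: contra_neq x1 => zz; apply: (addIr y); rewrite e2 e1 zz.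
have z13 : z1 != z3.
  by apply: contra_neq x1 => zz; apply: (addIr (- y)); rewrite e3 e1 zz.
have z23 : z2 != z3.
  (* A diagonal and an antidiagonal meet only once because [p.+1] is odd. *)
  apply: contra_neq x2 => zz; apply: (Zp_double_inj op).
  by have := congr2 +%R e2 e3; rewrite -zz addrACA subrr addr0 addrACA subrr addr0.
exists [set z1; z2; z3]; split.
- by rewrite !inE !negb_or x1 x2 x3.
- by rewrite finset.setUC cardsU1 !inE negb_or eq_sym z13 eq_sym z23 cards2 z12.
move=> tau; rewrite inE => /forallP av z zZ; rewrite leqNgt.
apply/negP => tau_zx; have := av z; rewrite tau_zx /=.
by move: zZ; rewrite !inE => /orP[/orP[]|] /eqP ->; rewrite -?e1 -?e2 -?e3 eqxx ?andbF.
Qed.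

(** Given [tau x = k], the column [f x] counts for at most 1 and each of the [p] others is free with
    probability at most [((m - k) / m)^3], so the expected number of free columns is at most
    [a k]. *)
Lemma mean_free_le1 (R : numFieldType) (p m : nat)
    (f : {ffun 'I_p.+1 -> 'I_p.+1}) (x : 'I_p.+1) (a : 'I_m -> R) :
  (0 < m)%N -> f \in queens p ->
  (forall k, a k = 1 + p%:R * ((m - k)%:R / m%:R) ^+ 3) ->
  mean (fun tau => #|free tau f x|%:R / a (tau x)) <= 1.
Proof.
move=> m0 fQ aE.
have a0 k : 0 < a k by rewrite aE ltr_wpDr// mulr_ge0// exprn_ge0// divr_ge0.
have thr (y : 'I_p.+1) (Z : {set 'I_p.+1}) : x \notin Z ->
    (forall tau : {ffun 'I_p.+1 -> 'I_m}, y \in free tau f x ->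
      {in Z, forall z, (tau x <= tau z)%N}) ->
    mean (fun tau : {ffun _ -> _} => (a (tau x))^-1 * (y \in free tau f x)%:R) <=
    m%:R^-1 * \sum_k (a k)^-1 * ((m - k)%:R / m%:R) ^+ #|Z|.
  move=> xZ yZ; rewrite -(mean_thresholds (fun k => (a k)^-1) xZ).
  apply: ler_mean => tau; rewrite ler_wpM2l ?invr_ge0 ?(ltW (a0 _))//.
  case: (boolP (y \in _)) => [/yZ leZ|_]; last first.
        by apply: prodr_ge0 => z _; rewrite ler0n.
  by rewrite big1// => z /leZ ->.
(* The size of the set [Z] used for [y]: empty for the queen's own column, the three attackers
   otherwise. *)
pose b (y : 'I_p.+1) : nat := if y == f x then 0%N else 3%N.
rewrite (eq_mean (psi := fun tau : {ffun _ -> _} =>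
    \sum_y (a (tau x))^-1 * (y \in free tau f x)%:R)); last first.
  by move=> tau; rewrite -big_distrr /= -natr_sum mulrC -sum1_card [in LHS]big_mkcond.
rewrite mean_sum.
apply: (@le_trans _ _ (\sum_y m%:R^-1 * \sum_k (a k)^-1 * ((m - k)%:R / m%:R) ^+ b y)).
  apply: ler_sum => y _; rewrite /b; case: eqVneq => /= [_|yfx].
    rewrite -(cards0 'I_p.+1); apply: thr; first by rewrite inE.
    by move=> tau _ z; rewrite inE.
  by have [Z [xZ <- yZ]] := attackers m fQ yfx; apply: thr.
rewrite -big_distrr /= exchange_big /=.
rewrite (eq_bigr (fun=> 1)) => [|k _].
  by rewrite sumr_const card_ord mulVf// pnatr_eq0 -lt0n.
rewrite -big_distrr /=; apply: (mulfI (lt0r_neq0 (a0 k))).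
rewrite mulrA divff ?lt0r_neq0// mul1r mulr1 aE.
rewrite (bigD1 (f x))//= {1}/b eqxx expr0; congr (_ + _).
rewrite (eq_bigr (fun=> ((m - k)%:R / m%:R) ^+ 3)) => [|y /negbTE yfx]; last by rewrite /b yfx.
rewrite sumr_const [RHS]mulr_natl; congr (_ *+ _).
by rewrite (eq_card (B := predC1 (f x))) ?cardC1 ?card_ord.
Qed.

(** * The entropy bound on the number of configurations *)

(** Averaged over [tau], the product attached to each [f] is at least [expR (- (p.+1 * L))], while
    for each [tau] these products sum to at most 1 over [f]. *)
Lemma card_queens_le_exp (R : realType) (p m : nat) (a : 'I_m -> R) :
  (0 < m)%N -> (forall k, a k = 1 + p%:R * ((m - k)%:R / m%:R) ^+ 3) ->
  #|queens p|%:R <= expR (p.+1%:R * (m%:R^-1 * \sum_k ln (a k))).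
Proof.
move=> m0 aE; set L := m%:R^-1 * _.
have a0 k : 0 < a k by rewrite aE ltr_wpDr// mulr_ge0// exprn_ge0// divr_ge0.
have m_neq0 : m%:R != 0 :> R by rewrite pnatr_eq0 -lt0n.
have lower (f : {ffun 'I_p.+1 -> 'I_p.+1}) : f \in queens p ->
    expR (- (p.+1%:R * L)) <= mean (fun tau : {ffun _ -> 'I_m} =>
      \prod_x #|free tau f x|%:R^-1).
  move=> fQ.
  (* An upper bound for the sum of [ln #|free tau f x|] whose mean is at most [p.+1 * L], by
     [mean_free_le1]. *)
  pose h (tau : {ffun 'I_p.+1 -> 'I_m}) : R :=
    \sum_x (ln (a (tau x)) + (#|free tau f x|%:R / a (tau x) - 1)).
  (* Jensen's inequality, for [ln] in [prod_h] and for [exp] in [exp_h],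
     through the tangent line bounds at the expected values. *)
  have prod_h tau : expR (- h tau) <= \prod_x #|free tau f x|%:R^-1.
    rewrite /h -sumrN expR_sum; apply: ler_prod => x _; rewrite expR_ge0 /=.
    have M0 : 0 < #|free tau f x|%:R :> R.
      by rewrite ltr0n; apply/card_gt0P; exists (f x); apply: mem_free.
    rewrite expRN lef_pV2 ?posrE ?expR_gt0// expRD lnK ?posrE//.
    rewrite -ler_pdivrMl// mulrC.
    by apply: le_trans (expR_ge1Dx _); rewrite addrC subrK.
  have exp_h tau :
      expR (- (p.+1%:R * L)) * (1 + (p.+1%:R * L + - h tau)) <= expR (- h tau).
    rewrite -[in leRHS](addKr (p.+1%:R * L) (- h tau)) expRD ler_wpM2l ?expR_ge0//.
    exact: expR_ge1Dx.
  apply: le_trans (ler_mean (fun tau => le_trans (exp_h tau) (prod_h tau))).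
  rewrite meanZ ler_peMr ?expR_ge0// !meanD meanN !mean_cst// lerDl subr_ge0.
  rewrite mean_sum -[p.+1 in leRHS]card_ord mulr_natl -sumr_const.
  apply: ler_sum => x _; rewrite !meanD mean_cst//.
  have -> : mean (fun tau : {ffun 'I_p.+1 -> 'I_m} => ln (a (tau x))) = L.
    rewrite (eq_mean (psi := fun tau : {ffun 'I_p.+1 -> 'I_m} => ln (a (tau x)) *
        \prod_(z in finset.set0) (tau x <= tau z)%N%:R)); last first.
      by move=> tau; rewrite big_set0 mulr1.
    rewrite (mean_thresholds (fun k => ln (a k))) ?finset.in_set0// cards0.
    by congr (_ * _); apply: eq_bigr => k _; rewrite expr0 mulr1.
  by rewrite gerDl subr_le0 mean_free_le1.
rewrite -[leRHS]mul1r -ler_pdivrMr ?expR_gt0// -expRN [leLHS]mulr_natl -sumr_const.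
apply: le_trans (ler_sum _ lower) _.
rewrite -mean_sum -[leRHS](mean_cst 'I_p.+1 1 m0).
by apply: ler_mean => tau; apply: sum_prod_inv_free_le1.
Qed.

(** * Estimating the average logarithm *)

(** A Riemann sum for the integral of [ln] over the unit interval, bounded through
    [ln m! <= (m + 1) ln m - m + 1]. *)
Lemma sum_ln_ratio_le (R : realType) (m : nat) : (0 < m)%N ->
  \sum_(k < m) ln (k.+1%:R / m%:R) <= 1 + ln m%:R - m%:R :> R.
Proof.
case: m => // m _.
under eq_bigr do rewrite ln_div ?posrE ?ltr0n//.
rewrite sumrB sumr_const card_ord -[ln _ *+ _]mulr_natl.
suff : \sum_(k < m.+1) ln k.+1%:R <= m.+2%:R * ln m.+1%:R - m%:R :> R.
  rewrite -(natr1 m.+1) -(natr1 m). set s := \sum_(k < _) _; lra.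
elim: m => [|m IHm]; first by rewrite big_ord1 ln1 mulr0 subr0.
rewrite big_ord_recr /=; set x := ln m.+1%:R in IHm; set y := ln m.+2%:R.
(* The inductive step reduces to this bound, which is [ln (1 - u) <= - u] at [u = 1 / m.+2]. *)
have xy : 1 <= m.+2%:R * (y - x).
  have m2 : 0 < m.+2%:R :> R by [].
  have := @le_ln1Dx R (- m.+2%:R^-1); rewrite ltrN2 invf_lt1// ltr1n => /(_ isT).
  have -> : 1 + - m.+2%:R^-1 = m.+1%:R / m.+2%:R :> R.
    apply: (mulIf (lt0r_neq0 m2)); rewrite divfK ?lt0r_neq0// mulrDl mulNr.
    by rewrite mulVf ?lt0r_neq0// mul1r -(natr1 m.+1) addrK.
  rewrite ln_div ?posrE// -/x -/y => le.
  rewrite -[leLHS](divff (lt0r_neq0 m2)) ler_pM2l//.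
  by rewrite -opprB lerNr.
have -> : m.+3%:R = m.+2%:R + 1 :> R by rewrite natr1.
rewrite -(natr1 m); set s := \sum_(_ < _) _ in IHm *; set w := m.+2%:R in xy IHm *.
lra.
Qed.

(** Taking [m = q^2] lets the crude bound [ln q <= q] give [ln m / m <= 2 / q], which tends to 0. *)
Lemma mean_ln_le (R : realType) (p q : nat) : (0 < q)%N ->
  (q ^ 2)%:R^-1 * \sum_(k < q ^ 2) ln (1 + p%:R * ((q ^ 2 - k)%:R / (q ^ 2)%:R) ^+ 3)
    <= ln p.+1%:R - 3 + (9 / q%:R + q%:R ^+ 6 / p.+1%:R) :> R.
Proof.
move=> q0; set m := (q ^ 2)%N.
have m0 : (0 < m)%N by rewrite expn_gt0 q0.
have mR : 0 < m%:R :> R by rewrite ltr0n.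
have qR : 1 <= q%:R :> R by rewrite ler1n.
have n0 : 0 < p.+1%:R :> R by [].
(* Reversal turns [(m - k) / m] into [(k + 1) / m]. *)
rewrite mulrC ler_pdivrMr// (reindex_inj rev_ord_inj) /=.
have term (k : 'I_m) : ln (1 + p%:R * ((m - (m - k.+1))%:R / m%:R) ^+ 3) <=
    ln p.+1%:R + 3 * ln (k.+1%:R / m%:R) + q%:R ^+ 6 / p.+1%:R :> R.
  rewrite subKn//; move tE : (k.+1%:R / m%:R) => t.
  have t0 : 0 < t by rewrite -tE divr_gt0.
  have t3 : 0 < p.+1%:R * t ^+ 3 by rewrite mulr_gt0// exprn_gt0.
  have -> : ln p.+1%:R + 3 * ln t = ln (p.+1%:R * t ^+ 3).
    by rewrite lnM ?posrE ?exprn_gt0// lnXn// mulr_natl.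
  (* The last factor adds at most [1 / (p.+1 t^3)] to the logarithm, and [t >= 1 / m] bounds this by
     [m^3 / p.+1 = q^6 / p.+1]. *)
  apply: (@le_trans _ _ (ln (p.+1%:R * t ^+ 3 * (1 + (p.+1%:R * t ^+ 3)^-1)))).
    have p3 : 0 <= p%:R * t ^+ 3 by rewrite mulr_ge0// exprn_ge0// ltW.
    rewrite mulrDr mulr1 divff ?lt0r_neq0// ler_ln ?posrE; last 2 first.
    - by rewrite ltr_pwDl.
    - by rewrite ltr_wpDr.
    by rewrite addrC lerD2r ler_wpM2r ?exprn_ge0 ?(ltW t0)// ler_nat.
  rewrite lnM ?posrE ?ltr_pwDl ?invr_ge0 ?(ltW t3)// lerD2l.
  apply: (@le_trans _ _ (p.+1%:R * t ^+ 3)^-1).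
    by apply: le_ln1Dx; rewrite (lt_trans (ltrN10 _))// invr_gt0.
  rewrite invfM mulrC ler_wpM2r ?invr_ge0// -tE expr_div_n invf_div.
  rewrite (_ : q%:R ^+ 6 = m%:R ^+ 3); last by rewrite /m natrX -exprM.
  by rewrite ler_pdivrMr ?exprn_gt0// ler_peMr ?exprn_ge0// exprn_ege1// ler1n.
apply: le_trans (ler_sum _ (fun k _ => term k)) _.
rewrite !big_split /= !sumr_const card_ord -big_distrr /=.
rewrite -[_ *+ m]mulr_natr -[(_ / _) *+ m]mulr_natr.
have := sum_ln_ratio_le R m0; set s := \sum_(k < m) _ => les.
(* With [3 <= 3 q], the error [3 (1 + ln m)] is at most [9 q], hence [9 / q] after division by
   [m]. *)
have lnm : ln m%:R <= 2 * q%:R :> R.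
  rewrite /m natrX lnXn ?ltr0n// -[ln _ *+ _]mulr_natl ler_pM2l//.
  by apply/ltW/ln_sublinear; rewrite ltr0n.
have mE : 9 / q%:R * m%:R = 9 * q%:R :> R.
  by rewrite /m natrX; field; rewrite pnatr_eq0 -lt0n.
rewrite [leRHS]mulrDl [(9 / _ + _) * _]mulrDl mE.
set c := _ / p.+1%:R * m%:R; set l := ln p.+1%:R.
clear term mE; clearbody m s c l; lra.
Qed.

(** * The bound on [T] and the limit *)

Lemma T_le (R : realType) (p q : nat) : (0 < q)%N ->
  (T p.+1)%:R <= (p.+1%:R / expR 1 ^+ 3 *
    expR (9 / q%:R + q%:R ^+ 6 / p.+1%:R)) ^+ p.+1 :> R.
Proof.
move=> q0; apply: le_trans (_ : #|queens p|%:R <= _); first by rewrite ler_nat T_le_queens.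
have m0 : (0 < q ^ 2)%N by rewrite expn_gt0 q0.
apply: le_trans (card_queens_le_exp m0 (fun=> erefl)) _.
rewrite expRM_natl lerXn2r ?nnegrE ?mulr_ge0 ?divr_ge0 ?expR_ge0 ?exprn_ge0 ?expR_ge0//.
apply: (@le_trans _ _ (expR (ln p.+1%:R - 3 + (9 / q%:R + q%:R ^+ 6 / p.+1%:R)))).
  by rewrite ler_expR mean_ln_le.
by rewrite expRD expRB lnK ?posrE// -expRM_natl mulr1.
Qed.

Lemma powR_inv_exprn (R : realType) (x : R) (n : nat) :
  0 <= x -> (x `^ n.+1%:R^-1) ^+ n.+1 = x.
Proof. by move=> x0; rewrite -powR_mulrn ?powR_ge0// -powRrM mulVf// powRr1. Qed.

Lemma exprn_powR_inv (R : realType) (x : R) (n : nat) :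
  0 <= x -> (x ^+ n.+1) `^ n.+1%:R^-1 = x.
Proof. by move=> x0; rewrite -powR_mulrn// -powRrM divff// powRr1. Qed.

Local Open Scope classical_set_scope.

Theorem theorem2 (R : realType) :
  exists eps : nat -> R,
    (eps n @[n --> \oo] --> (0 : R)) /\
    forall n : nat, (0 < n)%N ->
      (T n)%:R <= ((1 + eps n) * (n%:R / expR 1 ^+ 3)) ^+ n.
Proof.
pose c n : R := n%:R / expR 1 ^+ 3.
have c0 n : 0 < c n.+1 by rewrite divr_gt0// exprn_gt0// expR_gt0.
(* For positive [n], the least nonnegative value for which the bound holds. *)
pose eps n : R := Num.max 0 ((T n)%:R `^ n%:R^-1 / c n - 1).
exists eps; split; last first.
  case=> // n _; rewrite -/(c n.+1).
  have eps0 : 0 <= eps n.+1 by rewrite le_max lexx.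
  rewrite -[leLHS](powR_inv_exprn n)//.
  rewrite lerXn2r ?nnegrE ?powR_ge0 ?mulr_ge0 ?(ltW (c0 n)) ?addr_ge0//.
  by rewrite -ler_pdivrMr// -lerBlDl le_max lexx orbT.
apply/cvgrPdist_le => d d0.
have l0 : 0 < ln (1 + d) by rewrite ln_gt0// ltrDl.
(* First [q] makes [9 / q] at most half of [ln (1 + d)]; then, with [q] fixed, [n >= N] does the
   same for [q^6 / n]. *)
pose q := (Num.truncn (18 / ln (1 + d))).+1.
pose N := (Num.truncn (2 * q%:R ^+ 6 / ln (1 + d))).+1.
exists N => //= n nN.
rewrite sub0r normrN ger0_norm ?le_max ?lexx// ge_max (ltW d0) /=.
case: n nN => // n nN.
rewrite lerBlDl ler_pdivrMr//.
have n0 : 0 < n.+1%:R :> R by [].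
have qR : 18 / ln (1 + d) < q%:R by apply: Num.Theory.truncnS_gt.
have nR : 2 * q%:R ^+ 6 / ln (1 + d) < n.+1%:R.
  by apply: lt_le_trans (_ : N%:R <= _); [apply: Num.Theory.truncnS_gt|rewrite ler_nat].
have le1 : 9 / q%:R <= ln (1 + d) / 2.
  by rewrite ler_pdivrMr//; move: qR; rewrite ltr_pdivrMr//; lra.
have le2 : q%:R ^+ 6 / n.+1%:R <= ln (1 + d) / 2.
  by rewrite ler_pdivrMr//; move: nR; rewrite ltr_pdivrMr//; lra.
have le3 : expR (9 / q%:R + q%:R ^+ 6 / n.+1%:R) <= 1 + d.
  by rewrite -[leRHS]lnK ?posrE ?ltr_pwDl ?(ltW d0)// ler_expR [leRHS]splitr lerD.
have cd : 0 <= (1 + d) * c n.+1 by rewrite mulr_ge0 ?(ltW (c0 _)) ?addr_ge0 ?(ltW d0).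
have TX : (T n.+1)%:R <= ((1 + d) * c n.+1) ^+ n.+1.
  apply: le_trans (T_le R n (isT : 0 < q)%N) _.
  rewrite lerXn2r ?nnegrE// ?mulr_ge0 ?(ltW (c0 _)) ?expR_ge0//.
  by rewrite mulrC ler_wpM2r ?(ltW (c0 _)).
rewrite -[leRHS](exprn_powR_inv n)//.
by rewrite ge0_ler_powR ?nnegrE ?invr_ge0 ?exprn_ge0.
Qed.
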